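(* Let $A,P\in\mathbb{R}^{n\times n}$ be invertible, $b\in\mathbb{R}^n$, and consider NGMRES($m$) used to accelerate the preconditioned Richardson iteration $q(x)=x+P(b-Ax)$ for solving $g(x)=Ax-b=0$. Let $H=I-AP$ and $\bar r_{k}=Ax_{k}-b$. Then for every $k\ge0$ the least-squares problem defining $\boldsymbol{\beta}^{(k)}$ can be rewritten as $$\min_{\boldsymbol{\beta}^{(k)}}\|\bar r_{k+1}\|^2=\min_{\boldsymbol{\beta}^{(k)}}\|H\bar r_k-F_k\boldsymbol{\beta}^{(k)}\|^2,$$ i.e. for every coefficient vector $\boldsymbol{\beta}^{(k)}$ its objective equals $\|\bar r_{k+1}\|^2$ (with $x_{k+1}$, hence $\bar r_{k+1}$, regarded as a function of $\boldsymbol{\beta}^{(k)}$) and equals $\|H\bar r_k-F_k\boldsymbol{\beta}^{(k)}\|^2$, where $$F_k=[\,\bar r_k-H\bar r_k,\ \bar r_{k-1}-H\bar r_k,\ \dots,\ \bar r_{k-m_k}-H\bar r_k\,].$$ Moreover, for the iterates generated by NGMRES($m$) and all $i,j=0,1,\dots,m_k$, $$\bar r_{k+1}^TAP\bar r_k=0,\qquad \bar r_{k+1}^T(\bar r_{k-j}-\bar r_{k-i})=0,$$ and $$\|\bar r_{k+1}\|\le\|\bar r_k\|.$$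
   Context: $\|\cdot\|$ is the Euclidean 2-norm. NGMRES($m$) (nonlinear GMRES with depth $m$), $m\ge0$ an integer: given $x_0\in\mathbb{R}^n$, for $k=0,1,2,\dots$ let $m_k=\min\{k,m\}$ and set $$x_{k+1}=q(x_k)+\sum_{i=0}^{m_k}\beta_i^{(k)}\big(q(x_k)-x_{k-i}\big),$$ where $\boldsymbol{\beta}^{(k)}=(\beta_0^{(k)},\dots,\beta_{m_k}^{(k)})\in\mathbb{R}^{m_k+1}$ is obtained by solving the least-squares problem $$\min_{\boldsymbol{\beta}^{(k)}}\Big\|g(q(x_k))+\sum_{i=0}^{m_k}\beta_i^{(k)}\big(g(q(x_k))-g(x_{k-i})\big)\Big\|^2 .$$ *)

(* Defs.v *)
From mathcomp Require Import all_boot all_order all_algebra.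
From mathcomp Require Import reals.

Set Implicit Arguments.
Unset Strict Implicit.
Unset Printing Implicit Defensive.

Import Order.TTheory GRing.Theory Num.Theory.
Local Open Scope ring_scope.

(* The norm [`|v|] on matrices in MathComp-Analysis is the max norm, hence
   this definition of the Euclidean one. *)
Definition norm2 (R : realType) (n : nat) (v : 'cV[R]_n) : R :=
  Num.sqrt (\sum_(i < n) v i 0 ^+ 2).

Definition is_minimizer (R : realType) (T : Type) (f : T -> R) (t : T) : Prop :=
  forall s : T, f t <= f s.

(* Coefficient vectors at step k have m_k + 1 = (minn k m).+1 entries, so the
   truncated subtractions [k - i] below never truncate. *)
Definition ngmres_next (R : realType) (n : nat) (q : 'cV[R]_n -> 'cV[R]_n)
    (m k : nat) (x : nat -> 'cV[R]_n) (beta : 'cV[R]_(minn k m).+1) :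
    'cV[R]_n :=
  q (x k) + \sum_(i < (minn k m).+1) beta i 0 *: (q (x k) - x (k - i)%N).

Definition ngmres_objective (R : realType) (n : nat)
    (q g : 'cV[R]_n -> 'cV[R]_n) (m k : nat) (x : nat -> 'cV[R]_n)
    (beta : 'cV[R]_(minn k m).+1) : R :=
  norm2 (g (q (x k)) +
    \sum_(i < (minn k m).+1) beta i 0 *: (g (q (x k)) - g (x (k - i)%N))) ^+ 2.

(* A least-squares solution need not be unique: [beta] may be any choice of
   minimizers. *)
Definition ngmres (R : realType) (n : nat) (q g : 'cV[R]_n -> 'cV[R]_n)
    (m : nat) (x0 : 'cV[R]_n) (x : nat -> 'cV[R]_n)
    (beta : forall k : nat, 'cV[R]_(minn k m).+1) : Prop :=
  x 0%N = x0 /\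
  forall k : nat,
    is_minimizer (@ngmres_objective R n q g m k x) (beta k) /\
    x k.+1 = ngmres_next q x (beta k).

Definition residual (R : realType) (n : nat) (A : 'M[R]_n) (b x : 'cV[R]_n) :
    'cV[R]_n :=
  A *m x - b.

Definition richardson (R : realType) (n : nat) (A P : 'M[R]_n)
    (b x : 'cV[R]_n) : 'cV[R]_n :=
  x + P *m (b - A *m x).

Definition Fmx (R : realType) (n m k : nat) (H : 'M[R]_n)
    (r : nat -> 'cV[R]_n) : 'M[R]_(n, (minn k m).+1) :=
  \matrix_(i < n, j < (minn k m).+1) (r (k - j)%N - H *m r k) i 0.

(* Main.v *)
Require Import Defs.
From mathcomp Require Import all_boot all_order all_algebra.
From mathcomp Require Import reals.
From mathcomp Require Import ring lra.

(** Affinity of [g] is what makes the method tractable.  The Richardson step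
    multiplies the residual by [H = 1 - A P] ([residual_richardson]), and
    taking residuals commutes with combinations of differences, so the residual
    of the next iterate is [H r_k - F_k beta], an affine function of [beta]
    ([residual_ngmres_next]).  The objective is therefore the squared norm of
    the next residual itself, not of an approximation to it.

    Choosing [beta] is thus a linear least-squares problem, and a minimizer
    satisfies the normal equations: [r_{k+1}] is orthogonal to every column
    [r_{k-i} - H r_k] of [F_k] ([least_squares_orthogonal]).  The column of
    index 0 is [r_k - H r_k = A P r_k], and subtracting two columns cancels
    [H r_k], which gives both orthogonality relations.  Monotonicity holds
    because [r_k = H r_k + (r_k - H r_k)] is one of the competitors: it is
    reached by the coefficient vector with -1 in position 0 and 0 elsewhere. *)

Set Implicit Arguments.
Unset Strict Implicit.
Unset Printing Implicit Defensive.

Import Order.TTheory GRing.Theory Num.Theory.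
Local Open Scope ring_scope.

Section LeastSquares.
Variable R : realType.

Lemma sqr_norm2 n (v : 'cV[R]_n) : norm2 v ^+ 2 = (v^T *m v) 0 0.
Proof.
rewrite sqr_sqrtr; last by apply: sumr_ge0 => i _; rewrite sqr_ge0.
by rewrite mxE; apply: eq_bigr => i _; rewrite mxE expr2.
Qed.

Lemma sqr_norm2_eq0 n (v : 'cV[R]_n) : norm2 v ^+ 2 = 0 -> v = 0.
Proof.
rewrite sqr_sqrtr; last by apply: sumr_ge0 => i _; rewrite sqr_ge0.
move=> sum0; apply/matrixP => i j; rewrite ord1 mxE.
apply/eqP; rewrite -sqrf_eq0; apply/eqP.
by apply: (psumr_eq0P _ sum0) => // l _; rewrite sqr_ge0.
Qed.

Lemma sqr_norm2BZ n (v w : 'cV[R]_n) (t : R) :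
  norm2 (v - t *: w) ^+ 2
    = norm2 v ^+ 2 - 2 * t * (v^T *m w) 0 0 + t ^+ 2 * norm2 w ^+ 2.
Proof.
have dotC : (w^T *m v) 0 0 = (v^T *m w) 0 0.
  by rewrite -[w^T *m v]trmxK trmx_mul trmxK mxE.
have trBZ : (v - t *: w)^T = v^T - t *: w^T by rewrite linearB linearZ.
have entryB (X Y : 'M[R]_1) : (X - Y) 0 0 = X 0 0 - Y 0 0 by rewrite !mxE.
have entryZ (a : R) (X : 'M[R]_1) : (a *: X) 0 0 = a * X 0 0 by rewrite mxE.
rewrite !sqr_norm2 trBZ mulmxBl !mulmxBr -!scalemxAl -!scalemxAr.
by rewrite !(entryB, entryZ) dotC; ring.
Qed.

(** Normal equations.  With [v] the optimal residual, move the coefficients in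
    the direction [d = F^T v].  To first order the squared norm changes at
    rate [- 2 |d|^2], which contradicts minimality unless [d = 0]. *)
Lemma least_squares_orthogonal n p (F : 'M[R]_(n, p)) (y : 'cV[R]_n)
    (c : 'cV[R]_p) :
  is_minimizer (fun e => norm2 (y - F *m e) ^+ 2) c ->
  (y - F *m c)^T *m F = 0.
Proof.
move=> cmin; set v := y - F *m c; pose d := F^T *m v.
suff d0 : d = 0 by rewrite -[v^T *m F]trmxK trmx_mul trmxK -/d d0 trmx0.
apply: sqr_norm2_eq0; set S := norm2 d ^+ 2; set W := norm2 (F *m d) ^+ 2.
have W_ge0 : 0 <= W by rewrite sqr_ge0.
(* This step length exhibits a decrease as soon as [S != 0]; the summand 1
   avoids a separate treatment of [F d = 0]. *)
pose t := S / (1 + W).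
have St : S = t * (1 + W) by rewrite /t mulfVK // gt_eqF //; lra.
have : norm2 v ^+ 2 <= norm2 (v - t *: (F *m d)) ^+ 2.
  have -> : v - t *: (F *m d) = y - F *m (c + t *: d).
    by rewrite mulmxDr -scalemxAr opprD addrA.
  exact: cmin.
have vFd : (v^T *m (F *m d)) 0 0 = S.
  by rewrite /S sqr_norm2 {3}/d trmx_mul trmxK mulmxA.
rewrite sqr_norm2BZ vFd -/W St => le_t.
have t0 : t = 0.
  apply/eqP; rewrite -sqrf_eq0 eq_le sqr_ge0 andbT.
  have := mulr_ge0 (sqr_ge0 t) W_ge0; nra.
by rewrite t0 mul0r.
Qed.

End LeastSquares.

Section Residuals.
Variables (R : realType) (n : nat) (A P : 'M[R]_n) (b : 'cV[R]_n).

Lemma residual_richardson (x : 'cV[R]_n) :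
  residual A b (richardson A P b x) = (1%:M - A *m P) *m residual A b x.
Proof.
rewrite /residual /richardson mulmxBl mul1mx mulmxDr -mulmxA -[b - _]opprB.
by rewrite !mulmxN addrAC.
Qed.

(** Only the leading term carries [b]: in the differences it cancels, so they
    are transported by the linear part [A] alone. *)
Lemma residual_ngmres_next_affine (q : 'cV[R]_n -> 'cV[R]_n) m k
    (x : nat -> 'cV[R]_n) (c : 'cV[R]_(minn k m).+1) :
  residual A b (ngmres_next q x c)
    = residual A b (q (x k)) + \sum_(i < (minn k m).+1)
        c i 0 *: (residual A b (q (x k)) - residual A b (x (k - i)%N)).
Proof.
rewrite {1}/residual /ngmres_next mulmxDr mulmx_sumr addrAC; congr (_ + _).
apply: eq_bigr => i _.
by rewrite -scalemxAr mulmxBr /residual opprB addrA subrK.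
Qed.

Lemma Fmx_mul m k (H : 'M[R]_n) (r : nat -> 'cV[R]_n)
    (c : 'cV[R]_(minn k m).+1) :
  Fmx m k H r *m c
    = \sum_(i < (minn k m).+1) c i 0 *: (r (k - i)%N - H *m r k).
Proof.
apply/matrixP => i j; rewrite ord1 mxE summxE.
by apply: eq_bigr => l _; rewrite [Fmx _ _ _ _ _ _]mxE [in RHS]mxE mulrC.
Qed.

Lemma col_Fmx m k (H : 'M[R]_n) (r : nat -> 'cV[R]_n)
    (i : 'I_(minn k m).+1) :
  col i (Fmx m k H r) = r (k - i)%N - H *m r k.
Proof. by apply/matrixP => l j; rewrite ord1 [LHS]mxE [LHS]mxE. Qed.

Lemma residual_ngmres_next m k (x : nat -> 'cV[R]_n)
    (c : 'cV[R]_(minn k m).+1) :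
  let H := 1%:M - A *m P in
  let r := fun k => residual A b (x k) in
  residual A b (ngmres_next (richardson A P b) x c)
    = H *m r k - Fmx m k H r *m c.
Proof.
move=> H r; rewrite residual_ngmres_next_affine Fmx_mul.
rewrite -sumrN residual_richardson; congr (_ + _).
apply: eq_bigr => i _.
by rewrite -scalerN [- (r _ - _)]opprB.
Qed.

End Residuals.

Theorem theorem2p2 (R : realType) (n m : nat) (A P : 'M[R]_n)
    (b x0 : 'cV[R]_n) (x : nat -> 'cV[R]_n)
    (beta : forall k : nat, 'cV[R]_(minn k m).+1)
    (hA : A \in unitmx) (hP : P \in unitmx)
    (hx : ngmres (richardson A P b) (residual A b) x0 x beta) :
  let H : 'M[R]_n := 1%:M - A *m P in
  let r : nat -> 'cV[R]_n := fun k => residual A b (x k) in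
  forall k : nat,
    (forall c : 'cV[R]_(minn k m).+1,
       ngmres_objective (richardson A P b) (residual A b) x c
         = norm2 (residual A b (ngmres_next (richardson A P b) x c)) ^+ 2 /\
       ngmres_objective (richardson A P b) (residual A b) x c
         = norm2 (H *m r k - Fmx m k H r *m c) ^+ 2) /\
    (r k.+1)^T *m (A *m P *m r k) = 0 /\
    (forall i j : 'I_(minn k m).+1,
       (r k.+1)^T *m (r (k - j)%N - r (k - i)%N) = 0) /\
    norm2 (r k.+1) <= norm2 (r k).
Proof.
move=> H r k; have [xmin xS] := hx.2 k.
have objE (c : 'cV[R]_(minn k m).+1) :
    ngmres_objective (richardson A P b) (residual A b) x c
      = norm2 (residual A b (ngmres_next (richardson A P b) x c)) ^+ 2.
  by rewrite residual_ngmres_next_affine.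
have objF (c : 'cV[R]_(minn k m).+1) :
    ngmres_objective (richardson A P b) (residual A b) x c
      = norm2 (H *m r k - Fmx m k H r *m c) ^+ 2.
  by rewrite objE residual_ngmres_next.
have rS : r k.+1 = H *m r k - Fmx m k H r *m beta k.
  by rewrite /r xS residual_ngmres_next.
have ortho : (r k.+1)^T *m Fmx m k H r = 0.
  by rewrite rS; apply: least_squares_orthogonal => c; rewrite -!objF.
have ortho_col (i : 'I_(minn k m).+1) :
    (r k.+1)^T *m (r (k - i)%N - H *m r k) = 0.
  by rewrite -col_Fmx colE mulmxA ortho mul0mx.
split; first by move=> c; split.
split.
  have -> : A *m P *m r k = r k - H *m r k.
    by rewrite /H mulmxBl mul1mx opprB addrC subrK.
  by have := ortho_col ord0; rewrite subn0.
split.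
  move=> i j.
  have -> : r (k - j)%N - r (k - i)%N
      = (r (k - j)%N - H *m r k) - (r (k - i)%N - H *m r k).
    by rewrite [- (r _ - H *m _)]opprB addrA subrK.
  by rewrite mulmxBr !ortho_col subr0.
(* The competitor that reproduces the current residual [r k]. *)
have := xmin (- delta_mx ord0 0).
rewrite !objF -rS mulmxN opprK -colE col_Fmx subn0 addrC subrK.
by rewrite ler_pXn2r // nnegrE sqrtr_ge0.
Qed.
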